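(* Let $n$ be a positive integer and let $d\in\Delta(n)$. Write $d=(d_1,\dots,d_L)$ with $d_L>0$ the last nonzero entry, and let $q=\max_k d_k$, so that $d=(1,2,\dots,q,d_{q+1},\dots,d_L)$ with $d_{q+1}\le q$. Set $b_i=d_i-d_{i+1}$ for $q\le i<L$ and $b_L=d_L$. Then the number of partitions $\alpha\in\mathcal{P}(n)$ with $\delta(\alpha)=d$ is \[\big|\,[\,d\,]\,\big|=\prod_{i=q}^{L-1}\binom{b_i+b_{i+1}+1}{b_i+1},\] where an empty product equals $1$.
   Context: A partition of a positive integer $n$ is a finite non-increasing sequence $\alpha=(\alpha_1,\dots,\alpha_l)$ of positive integers with $\sum_i\alpha_i=n$; $\mathcal{P}(n)$ denotes the set of partitions of $n$, and we set $\alpha_i=0$ for $i>l$. The diagonal sequence of $\alpha$ is $\delta(\alpha)=(d_k)_{k\ge1}$ with $d_k=\big|\{i : 1\le i\le k,\ \alpha_i+i-1\ge k\}\big|$; only finitely many $d_k$ are nonzero and trailing zeros are omitted. $\Delta(n)=\{\delta(\alpha):\alpha\in\mathcal{P}(n)\}$, and for $d\in\Delta(n)$, $[\,d\,]=\{\alpha\in\mathcal{P}(n):\delta(\alpha)=d\}$. *)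

(* Defs.v *)
From mathcomp Require Import all_boot.
Set Implicit Arguments. Unset Strict Implicit. Unset Printing Implicit Defensive.

Definition is_partition (n : nat) (a : seq nat) : bool :=
  [&& sorted geq a, all (fun x => 0 < x) a & sumn a == n].

Definition part_at (a : seq nat) (i : nat) : nat := nth 0 a i.-1.

Definition diag_entry (a : seq nat) (k : nat) : nat :=
  count (fun i => k <= part_at a i + i - 1) (iota 1 k).

Fixpoint drop_lead_zeros (s : seq nat) : seq nat :=
  if s is x :: s' then (if x == 0 then drop_lead_zeros s' else s) else [::].
Definition trim_zeros (s : seq nat) : seq nat := rev (drop_lead_zeros (rev s)).

(* the diagonal sequence (d_1, d_2, ...) with trailing zeros omitted;
   d_k = 0 whenever k > alpha_1 + l - 1, so sumn a + size a terms suffice *)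
Definition delta (a : seq nat) : seq nat :=
  trim_zeros (mkseq (fun j => diag_entry a j.+1) (sumn a + size a)).

Definition in_Delta (n : nat) (d : seq nat) : Prop :=
  exists a, is_partition n a /\ delta a = d.

Definition dseq (d : seq nat) (i : nat) : nat := nth 0 d i.-1.

(* b_i = d_i - d_{i+1}  (for i = L this is d_L since d_{L+1} = 0) *)
Definition bcoef (d : seq nat) (i : nat) : nat := dseq d i - dseq d i.+1.

(* Main.v *)
(* Put the Young diagram of a partition with delta(a) = d, where d has length L,
   inside the staircase (L, ..., 1, 0), and let h_j = j - a_{L+1-j} (0 <= j <= L)
   be the gaps to the staircase.  Being a partition means h_0 = 0 and
   h_{j+1} <= h_j + 1, and d_k counts the rows with gap at most L - k, up to
   the L + 1 - k rows that always have this property; hence fixing d amounts to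
   fixing the number c_v = b_{L-v} + 1 of gaps equal to v, for 0 <= v <= L - q.
   Deleting all maximal entries M from such an h gives a sequence of the same
   kind, and h is recovered by placing a (possibly empty) run of entries M
   directly after each M - 1.  So the top level contributes the number
   binom(c_{M-1} + c_M - 1, c_M) of weak compositions of c_M into c_{M-1}
   parts, and the product follows by induction on M. *)
Require Import Defs.
From mathcomp Require Import all_boot zify.
Set Implicit Arguments. Unset Strict Implicit. Unset Printing Implicit Defensive.

(** * Area sequences, runs of a maximal value, and weak compositions *)

Definition climb : rel nat := fun x y => y <= x.+1.

(** These are the area sequences of Dyck paths; the default of [head] admits the empty one. *)
Definition area_seq (h : seq nat) : bool := (head 0 h == 0) && sorted climb h.

(* After the i-th occurrence of [m] in [g], insert [t_i] copies of [m.+1]. *)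
Fixpoint insert_runs (m : nat) (g t : seq nat) : seq nat :=
  if g is x :: g' then
    if x == m then x :: nseq (head 0 t) m.+1 ++ insert_runs m g' (behead t)
    else x :: insert_runs m g' t
  else [::].

(** The position of the first entry other than [m.+1] is the length of the run of [m.+1] directly
    after the current [m]. *)
Fixpoint runs (m : nat) (h : seq nat) : seq nat :=
  if h is x :: h' then
    if x == m then find (predC1 m.+1) h' :: runs m h' else runs m h'
  else [::].

(** Pascal's rule, according to whether the first part is zero. For [k = 0] the truncated
    subtraction still gives 1 if [b = 0] and 0 otherwise. *)
Lemma weak_compositions k b :
  exists s : seq (seq nat),
    [/\ uniq s, (forall t, (t \in s) = (size t == k) && (sumn t == b)) &
        size s = 'C(k + b - 1, b)].
Proof.
elim: k b => [|k IHk] b.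
  case: b => [|b].
    exists [:: [::]]; split=> // -[|x t] //.
  exists [::]; split=> [//|[|x t] //|].
  by rewrite bin_small // add0n subn1.
elim: b => [|b [s1 [us1 ms1 ss1]]].
  have [s [us ms ss]] := IHk 0; exists [seq 0 :: t | t <- s].
  split; first by rewrite map_inj_uniq // => x y [].
    case=> [|[|x] t].
    - by apply/mapP => -[].
    - rewrite mem_map; last by move=> ? ? [].
      by rewrite ms.
    - by rewrite /= andbF; apply/mapP => -[].
  by rewrite size_map ss !bin0.
have [s [us ms ss]] := IHk b.+1.
(* A positive first part arises by adding one to the first part of a composition of [b] into [k.+1]
   parts. *)
pose bump (t : seq nat) := (head 0 t).+1 :: behead t.
exists ([seq 0 :: t | t <- s] ++ [seq bump t | t <- s1]); split.
- rewrite cat_uniq map_inj_uniq ?us /=; last by move=> ? ? [].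
  apply/andP; split.
    by apply/hasPn => _ /mapP[t _ ->]; apply/negP => /mapP[].
  rewrite map_inj_in_uniq // => -[|x t] [|y t']; rewrite ?ms1 //= => _ _.
  by case=> -> ->.
- case=> [|[|x] t]; rewrite mem_cat.
  + by apply/orP => -[] /mapP[].
  + rewrite mem_map; last by move=> ? ? [].
    rewrite ms orbC; case: mapP => [[//]|_] /=.
    by rewrite eqSS add0n.
  + case: mapP => [[? _ //]|_] /=.
    apply/mapP/idP => [[[|y t'] ht []]|/andP[h1 h2]].
    * by move: ht; rewrite ms1.
    * by move=> -> ->; move: ht; rewrite ms1 /= addSn eqSS.
    * by exists (x :: t) => //; rewrite ms1 /= h1; rewrite addSn eqSS in h2.
- rewrite size_cat !size_map ss ss1.
  have -> : k + b.+1 - 1 = k + b by lia.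
  have -> : k.+1 + b - 1 = k + b by lia.
  have -> : k.+1 + b.+1 - 1 = (k + b).+1 by lia.
  by rewrite binS.
Qed.

(** * Inserting and deleting the maximal entries are mutually inverse *)

Section Insertion.
Variable m : nat.
Implicit Types (g h t : seq nat).

Let low g := all (fun x => x <= m) g.

Lemma head_insert_runs g t : head 0 (insert_runs m g t) = head 0 g.
Proof. by case: g => [|x g] //=; case: ifP. Qed.

(** Hence the copies inserted after an [m] form the whole run there, and [runs] reads back their
    exact number. *)
Lemma find_insert_runs g t : low g -> find (predC1 m.+1) (insert_runs m g t) = 0.
Proof.
case: g => [|x g] //= /andP[hx _].
by case: ifP => _ /=; rewrite neq_ltn ltnS hx.
Qed.

Lemma runs_nseq_cat k h : runs m (nseq k m.+1 ++ h) = runs m h.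
Proof. by elim: k => //= k ->; case: eqP => //; lia. Qed.

Lemma filter_insert_runs g t : low g ->
  filter (predC1 m.+1) (insert_runs m g t) = g.
Proof.
elim: g t => [|x g IH] t //= /andP[hx hg].
have nx : x != m.+1 by lia.
case: ifP => _ /=; rewrite nx ?filter_cat IH //.
by rewrite filter_nseq /= eqxx.
Qed.

Lemma runs_insert_runs g t :
  low g -> size t = count_mem m g -> runs m (insert_runs m g t) = t.
Proof.
elim: g t => [|x g IH] t /=; first by move=> _ /size0nil.
case/andP=> hx hg; case: (eqVneq x m) => [->|nx] /= ht; last first.
  by rewrite (negbTE nx) IH.
rewrite eqxx runs_nseq_cat; case: t ht => [|k t] //= [ht].
rewrite IH // find_cat has_nseq /= eqxx andbF size_nseq find_insert_runs //.
by rewrite addn0.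
Qed.

(** The initial run of [m.+1] follows no [m], so [runs] misses it; restoring it separately lets the
    induction pass to tails. *)
Lemma insert_runsK h : all (fun x => x <= m.+1) h -> sorted climb h ->
  nseq (find (predC1 m.+1) h) m.+1 ++
    insert_runs m (filter (predC1 m.+1) h) (runs m h) = h.
Proof.
elim: h => [|x h IH] //= /andP[hx hh] ph.
have := IH hh (path_sorted ph).
case: (eqVneq x m.+1) => [->|nx] /= E.
  by case: eqP => [|_]; [lia | rewrite E].
case: (eqVneq x m) => [-> /=|nxm]; first by rewrite E.
(* Here [x < m], and [climb] forbids [m.+1] right after it. *)
rewrite -[in RHS]E; suff -> : find (predC1 m.+1) h = 0 by [].
by case: h ph {IH hh E} => [|y h] //= /andP[]; rewrite /climb; case: eqP => //; lia.
Qed.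

Lemma path_insert_runs x g t :
  low g -> path climb x g -> path climb x (insert_runs m g t).
Proof.
elim: g x t => [|y g IH] x t //= /andP[hy hg] /andP[xy pg].
case: eqP => [ym|_] /=; rewrite xy /=; last exact: IH.
(* Only ascents are bounded, so the start may be raised; after a nonempty run it becomes [m.+1]. *)
have {}IH z : y <= z -> path climb z (insert_runs m g (behead t)).
  move=> yz; apply: IH => //.
  by case: g hg pg => //= w g _ /andP[yw ->]; rewrite andbT /climb in yw *; lia.
move: (head 0 t) => k; case: k => [|k] /=; first exact: IH.
rewrite /climb ym leqnn /=; elim: k => [|k IHk] /=; last by rewrite IHk leqnSn.
by apply: IH; rewrite ym.
Qed.

Lemma area_insert_runs g t :
  low g -> area_seq g -> area_seq (insert_runs m g t).
Proof.
rewrite /area_seq head_insert_runs => hg /andP[-> sg] /=.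
case: g hg sg => [|x g] // hg sg.
have pg : path climb x (x :: g) by rewrite /= /climb leqnSn.
by have := path_insert_runs t hg pg => /=; case: ifP => _ /= /andP[].
Qed.

(** The entry before a deleted run is at least [m] and the next survivor is at most [m], so closing
    the gap creates no ascent. *)
Lemma sorted_filter_low h : all (fun x => x <= m.+1) h -> sorted climb h ->
  sorted climb (filter (predC1 m.+1) h).
Proof.
have key x h' : all (fun x => x <= m.+1) h' -> path climb x h' ->
    path climb x (filter (predC1 m.+1) h').
  elim: h' x => [|y h' IH] x //= /andP[hy hh] /andP[xy ph].
  case: (eqVneq y m.+1) => [Ey|ny] /=; last by rewrite xy IH.
  have := IH _ hh ph; have := filter_all (predC1 m.+1) h'.
  have : all (fun x => x <= m.+1) (filter (predC1 m.+1) h').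
    by apply/allP => z; rewrite mem_filter => /andP[_ /(allP hh)].
  case: (filter _ _) => //= z l /andP[hz _] /andP[nz _] /andP[_ ->].
  by rewrite andbT /climb in xy *; lia.
elim: h => [|x h IH] //= /andP[hx hh] ph.
case: ifP => _ /=; first exact: key.
exact: IH hh (path_sorted ph).
Qed.

Lemma area_filter h : all (fun x => x <= m.+1) h -> area_seq h ->
  area_seq (filter (predC1 m.+1) h).
Proof.
move=> hh /andP[h0 sh]; rewrite /area_seq sorted_filter_low // andbT.
by case: h h0 {hh sh} => [|x h] //= /eqP ->.
Qed.

Lemma count_insert_runs_le g t v : low g -> v <= m ->
  count_mem v (insert_runs m g t) = count_mem v g.
Proof.
move=> hg hv; rewrite -[in RHS](filter_insert_runs t hg) count_filter.
by apply: eq_count => x /=; case: eqP => // ->; rewrite neq_ltn ltnS hv.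
Qed.

Lemma count_insert_runs_top g t : low g -> size t = count_mem m g ->
  count_mem m.+1 (insert_runs m g t) = sumn t.
Proof.
elim: g t => [|x g IH] t /=; first by move=> _ /size0nil ->.
case/andP=> hx hg; have /negbTE nx : x != m.+1 by lia.
case: (eqVneq x m) => [Ex|nxm] /= ht; last by rewrite nx IH.
case: t ht => [|k t] //= [ht]; rewrite nx count_cat IH //.
by rewrite count_nseq /= eqxx mul1n.
Qed.

Lemma all_insert_runs g t :
  low g -> all (fun x => x <= m.+1) (insert_runs m g t).
Proof.
elim: g t => [|x g IH] t //= /andP[hx hg].
case: ifP => _ /=; rewrite (leqW hx) ?all_cat IH //.
by rewrite all_nseq leqnn orbT.
Qed.

(** An area sequence does not start with [m.+1], so the initial run in [insert_runsK] is empty. *)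
Lemma area_insert_runsK h : all (fun x => x <= m.+1) h -> area_seq h ->
  insert_runs m (filter (predC1 m.+1) h) (runs m h) = h.
Proof.
move=> hh /andP[h0 sh]; rewrite -[RHS](insert_runsK hh sh).
by case: h h0 {hh sh} => [|x h] //= /eqP ->.
Qed.

Lemma all_filter_low h : all (fun x => x <= m.+1) h -> low (filter (predC1 m.+1) h).
Proof.
move=> hh; apply/allP => x; rewrite mem_filter /= => /andP[nx /(allP hh)].
by lia.
Qed.

Lemma size_runs h : size (runs m h) = count_mem m h.
Proof. by elim: h => //= x h IH; case: eqP => //= _; rewrite IH. Qed.

Lemma sumn_runs h : all (fun x => x <= m.+1) h -> area_seq h ->
  sumn (runs m h) = count_mem m.+1 h.
Proof.
move=> hh ah; rewrite -{2}(area_insert_runsK hh ah) count_insert_runs_top //.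
  exact: all_filter_low.
rewrite size_runs count_filter; apply: eq_count => x /=.
by case: eqP => // ->; lia.
Qed.

End Insertion.

(** * Counting area sequences with prescribed multiplicities *)

Lemma area_seq_enum (c : nat -> nat) M :
  exists s : seq (seq nat),
    [/\ uniq s,
        (forall h, (h \in s) = [&& area_seq h, all (fun x => x <= M) h &
           all (fun v => count_mem v h == c v) (iota 0 M.+1)]) &
        size s = \prod_(0 <= v < M) 'C(c v + c v.+1 - 1, c v.+1)].
Proof.
elim: M => [|m [s1 [us1 ms1 ss1]]].
  exists [:: nseq (c 0) 0]; split=> //; last by rewrite big_nil.
  move=> h; rewrite inE /= andbT; apply/eqP/and3P => [->|[_ h0 /eqP <-]].
    rewrite count_nseq mul1n eqxx all_nseq orbT; split=> //.
    by rewrite /area_seq; case: (c 0) => //= k; elim: k.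
  elim: h h0 => //= x h IH /andP[]; rewrite leqn0 => /eqP -> /IH {1}->.
  by [].
have [s2 [us2 ms2 ss2]] := weak_compositions (c m) (c m.+1).
have s1P h : h \in s1 -> [/\ area_seq h, all (fun x => x <= m) h &
    forall v, v <= m -> count_mem v h = c v].
  rewrite ms1 => /and3P[-> -> /allP H]; split=> // v hv.
  by apply/eqP/H; rewrite mem_iota.
have s2P t : t \in s2 -> size t = c m /\ sumn t = c m.+1.
  by rewrite ms2 => /andP[/eqP-> /eqP->].
(* [g] is the sequence without its top level, [t] distributes the [c m.+1] top entries over the
   [c m] occurrences of [m]. *)
exists [seq insert_runs m g t | g <- s1, t <- s2]; split.
- apply: allpairs_uniq => // -[g t] [g' t'] /=.
  case/allpairsP=> -[a b] /= [ha hb [-> ->]].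
  case/allpairsP=> -[a' b'] /= [ha' hb' [-> ->]] E.
  have [[_ la ca] [_ la' ca']] := (s1P _ ha, s1P _ ha').
  have [[zb _] [zb' _]] := (s2P _ hb, s2P _ hb').
  rewrite -(filter_insert_runs b la) E filter_insert_runs //; congr (_, _).
  rewrite -(runs_insert_runs la (t := b)) ?zb ?ca // E runs_insert_runs //.
  by rewrite zb' ca'.
- move=> h; apply/allpairsP/and3P.
    case=> -[g t] [/s1P[ag lg cg] /s2P[zt st] ->]; move: ag lg cg zt st.
    rewrite [(g, t).1]/= [(g, t).2]/= => ag lg cg zt st; split.
    + exact: area_insert_runs.
    + exact: all_insert_runs.
    + apply/allP => v; rewrite mem_iota add0n /= ltnS leq_eqVlt => /orP[/eqP->|hv].
        by rewrite count_insert_runs_top ?st // zt cg.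
      by rewrite count_insert_runs_le // cg.
  case=> ah lh /allP ch.
  have {}ch v : v <= m.+1 -> count_mem v h = c v.
    by move=> hv; apply/eqP/ch; rewrite mem_iota.
  exists (filter (predC1 m.+1) h, runs m h); rewrite [(_, _).1]/= [(_, _).2]/=; split.
  + rewrite ms1 area_filter // all_filter_low //.
    apply/allP => v; rewrite mem_iota add0n /= => hv.
    rewrite count_filter -ch; last by lia.
    apply/eqP/eq_count => x /=; case: eqP => // ->.
    by lia.
  + by rewrite ms2 size_runs sumn_runs // !ch ?eqxx.
  + by rewrite /= area_insert_runsK.
- by rewrite size_allpairs ss1 ss2 big_nat_recr.
Qed.

(** * Occupied levels and cumulative counts *)

(** A discrete intermediate value property: the sequence starts at 0 and climbs by at most one. *)
Lemma mem_area_seq h x v : area_seq h -> x \in h -> v <= x -> v \in h.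
Proof.
have key y l : path climb y l -> y <= v -> x \in y :: l -> v <= x -> v \in y :: l.
  elim: l y => [|z l IH] y /=.
    by move=> _ yv; rewrite !inE => /eqP -> vy; rewrite eqn_leq vy yv.
  case/andP=> yz pl yv; rewrite !inE => /orP[/eqP->|xl] vx.
    by rewrite (_ : v = y) ?eqxx //; lia.
  case: (eqVneq v y) => //= nvy.
  by have := IH z pl _ xl vx; rewrite inE; apply; rewrite /climb in yz; lia.
case: h => [|y h] //= /andP[/eqP /= -> ph]; exact: key.
Qed.

Lemma count_leqS v h :
  count (fun x => x <= v.+1) h = count (fun x => x <= v) h + count_mem v.+1 h.
Proof.
elim: h => //= x h ->; rewrite (leq_eqVlt x) ltnS.
case: (eqVneq x v.+1) => [->|_]; last by rewrite add0n addnA.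
by rewrite ltnn add0n addnCA.
Qed.

Lemma count_leq0 h : count (fun x => x <= 0) h = count_mem 0 h.
Proof. by apply: eq_count => x /=; rewrite leqn0. Qed.

(** Multiplicities are differences of consecutive cumulative counts. *)
Lemma perm_eq_count_leq h h' :
  (forall v, count (fun x => x <= v) h = count (fun x => x <= v) h') ->
  perm_eq h h'.
Proof.
move=> E; apply/allP => -[|v] _ /=; first by rewrite -!count_leq0 E.
by apply/eqP; have := E v.+1; rewrite !count_leqS E => /addnI.
Qed.

Lemma leq_bigmax_mem (s : seq nat) x : x \in s -> x <= \max_(y <- s) y.
Proof. by move=> xs; apply: (@leq_bigmax_seq _ _ xpredT id). Qed.

Lemma bigmax_mem (s : seq nat) : s != [::] -> \max_(y <- s) y \in s.
Proof.
elim: s => // x [|y s] IH _; first by rewrite big_seq1 inE.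
rewrite big_cons; move: (\max_(z <- y :: s) z) (IH isT) => m hm.
by rewrite /maxn; case: ifP => _; rewrite inE ?hm ?eqxx ?orbT.
Qed.

(** Every level up to the maximum is occupied, so each of the [j] levels adds at least one entry. *)
Lemma area_seq_count_leq h v j :
  area_seq h -> v + j <= \max_(x <- h) x ->
  count (fun x => x <= v) h + j <= count (fun x => x <= v + j) h.
Proof.
move=> ah; elim: j => [|j IH] hj; first by rewrite !addn0.
have h0 : h != [::] by case: h hj {ah IH} => //; rewrite big_nil; lia.
rewrite addnS in hj; rewrite !addnS count_leqS.
have : 0 < count_mem (v + j).+1 h.
  by rewrite -has_count has_pred1; apply: mem_area_seq hj => //; apply: bigmax_mem.
by have := IH (ltnW hj); lia.
Qed.

Lemma area_seq_perm_enum h0 :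
  area_seq h0 ->
  exists s : seq (seq nat),
    [/\ uniq s, (forall h, (h \in s) = area_seq h && perm_eq h h0) &
        size s = \prod_(0 <= v < \max_(x <- h0) x)
          'C(count_mem v h0 + count_mem v.+1 h0 - 1, count_mem v.+1 h0)].
Proof.
move=> ah0; set M := \max_(x <- h0) x.
have [s [us ms ss]] := area_seq_enum (fun v => count_mem v h0) M.
exists s; split=> // h; rewrite ms; congr (_ && _).
have leM x : x \in h0 -> x <= M by exact: leq_bigmax_mem.
apply/andP/idP => [[/allP lh /allP ch]|ph].
  apply/allP => x _; case: (leqP x M) => hx.
    by apply: ch; rewrite mem_iota.
  (* Above [M] both multiplicities vanish: in [h0] by maximality, in [h] by its bound. *)
  apply/eqP => /=; rewrite !(count_memPn _) //; apply/negP.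
    by move/leM; lia.
  by move/lh; lia.
split; first by apply/allP => x; rewrite (perm_mem ph) => /leM.
by apply/allP => v _; apply/eqP/permP.
Qed.

(** * Partitions and diagonal sequences as sequences extended by zeros *)

Definition part_seq (a : seq nat) : bool := sorted geq a && all (fun x => 0 < x) a.

Lemma part_seq_nthS a i : sorted geq a -> nth 0 a i.+1 <= nth 0 a i.
Proof.
move=> sa; case: (ltnP i.+1 (size a)) => hi; last by rewrite nth_default.
by have /sortedP := sa; move=> /(_ 0 i hi).
Qed.

(** The default 1 of [last] lets the empty sequence count as having no trailing zero. *)
Lemma eq_from_nth_last (s t : seq nat) :
  last 1 s != 0 -> last 1 t != 0 -> (forall i, nth 0 s i = nth 0 t i) -> s = t.
Proof.
have key u v : last 1 v != 0 -> (forall i, nth 0 u i = nth 0 v i) ->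
    size v <= size u.
  move=> lv E; rewrite leqNgt; apply/negP => lt.
  case: v lv E lt => // x v lv E lt.
  have := E (size v); rewrite nth_default; last by rewrite /= in lt; lia.
  move=> /esym; rewrite -[size v]/(size (x :: v)).-1 nth_last => /eqP.
  by rewrite (negbTE lv).
move=> ls lt E; apply: (@eq_from_nth _ 0) => //.
by apply/eqP; rewrite eqn_leq !key.
Qed.

Lemma last_part_seq a : part_seq a -> last 1 a != 0.
Proof.
case: a => // x a /andP[_ /allP pa] /=.
by rewrite -lt0n; apply: pa; rewrite mem_last.
Qed.

Lemma trim_zerosE s : exists k, s = trim_zeros s ++ nseq k 0.
Proof.
have [k E] : exists k, rev s = nseq k 0 ++ drop_lead_zeros (rev s).
  elim: (rev s) => [|x l [k E]]; first by exists 0.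
  rewrite /=; case: eqP => [->|_]; last by exists 0.
  by exists k.+1; rewrite /= -E.
by exists k; rewrite -[LHS]revK E rev_cat rev_nseq.
Qed.

Lemma nth_trim_zeros s i : nth 0 (trim_zeros s) i = nth 0 s i.
Proof.
have [k {2}->] := trim_zerosE s; rewrite nth_cat nth_nseq if_same.
by case: ltnP => // /(nth_default _) ->.
Qed.

Lemma last_trim_zeros s : last 1 (trim_zeros s) != 0.
Proof.
rewrite /trim_zeros; elim: (rev s) => // x l IH /=.
by case: (eqVneq x 0) => // nx; rewrite rev_cons last_rcons.
Qed.

(** The cutoff loses nothing: a nonempty row has index at most [size a] and length at most [sumn a],
    and an empty row [i <= k] never reaches diagonal [k]. *)
Lemma nth_delta a j : nth 0 (delta a) j = diag_entry a j.+1.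
Proof.
rewrite /delta nth_trim_zeros; case: (ltnP j (sumn a + size a)) => hj.
  by rewrite nth_mkseq.
rewrite nth_default ?size_mkseq // /diag_entry; apply/esym/eqP.
rewrite -leqn0 leqNgt -has_count; apply/hasPn => i; rewrite mem_iota => hi.
have le_sum l x : nth 0 l x <= sumn l.
  by elim: l x => [|y l IH] [|x] //=; [lia | have := IH x; lia].
rewrite /part_at; have := le_sum a i.-1.
case: (ltnP i.-1 (size a)) => hs; first by lia.
by rewrite nth_default //; lia.
Qed.

Lemma delta_eqP a b :
  (forall k, 0 < k -> diag_entry a k = diag_entry b k) <-> delta a = delta b.
Proof.
split=> [E|E [|k] // _]; last by rewrite -!nth_delta E.
apply: eq_from_nth_last; try exact: last_trim_zeros.
by move=> i; rewrite !nth_delta E.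
Qed.

(* Read from the bottom row up, [h] lists the gaps between the rows of [a] and
   those of the staircase (L, L-1, ..., 1, 0). *)
Definition stair_gaps (L : nat) (a h : seq nat) : Prop :=
  [/\ size h = L.+1, size a <= L &
      forall j, j <= L -> nth 0 h j + nth 0 a (L - j) = j].

(** * Diagonal entries and size in terms of staircase gaps *)

Lemma diag_entry_sum a k :
  diag_entry a k = \sum_(0 <= i < k) (k <= nth 0 a i + i).
Proof.
rewrite /diag_entry (iotaDl 1 0 k) count_map -sum1_count big_mkcond.
rewrite /index_iota subn0; apply: eq_bigr => i _ /=.
by rewrite /part_at add1n addnS subn1 /=; case: leqP.
Qed.

Lemma stair_gaps_leq L a h x : stair_gaps L a h -> x \in h -> x <= L.
Proof.
case=> sh _ E /(nthP 0)[j]; rewrite sh ltnS => hj <-.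
by have := E j hj => /=; lia.
Qed.

Lemma count_stair_gaps L a h k : stair_gaps L a h -> 0 < k <= L ->
  count (fun x => x <= L - k) h = diag_entry a k + (L.+1 - k).
Proof.
case=> sh sa E /andP[k0 kL].
rewrite -sum1_count big_mkcond (big_nth 0) sh /=.
(* Positions [j < L.+1 - k] have gap at most [j <= L - k] for free. The others, read backwards, are
   the rows [i < k], where the gap [L - i - a_i] is at most [L - k] exactly when [k <= a_i + i]. *)
rewrite (@big_cat_nat _ _ _ (L.+1 - k)) //=; last by lia.
rewrite addnC; congr (_ + _).
  rewrite diag_entry_sum -{1}[L.+1 - k]add0n big_addn.
  have -> : L.+1 - (L.+1 - k) = k by lia.
  rewrite big_nat_rev /=; apply: eq_big_nat => i /andP[_ hi].
  have hj : 0 + k - i.+1 + (L.+1 - k) = L - i by lia.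
  rewrite hj; have := E (L - i) (leq_subr _ _).
  rewrite subKn; last by lia.
  by move=> e; case: ifP; case: leqP => //; lia.
rewrite (eq_big_nat _ _ (F2 := fun=> 1)); first by rewrite sum_nat_const_nat subn0 muln1.
move=> i /andP[_ hi]; have := E i.
by case: ifP => //; lia.
Qed.

Lemma diag_entry_stair0 L a h k : stair_gaps L a h -> L < k -> diag_entry a k = 0.
Proof.
case=> sh sa E hk; rewrite diag_entry_sum big_nat big1 // => i /andP[_ hi].
case: (leqP i L) => iL; last by rewrite nth_default; lia.
by have := E (L - i) (leq_subr _ _); rewrite subKn //; lia.
Qed.

(** The total is the size of the staircase, so permuting the gaps preserves the size of the
    partition. *)
Lemma sumn_stair_gaps L a h : stair_gaps L a h ->
  sumn a + sumn h = \sum_(0 <= j < L.+1) j.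
Proof.
case=> sh sa E.
have -> : sumn a = \sum_(0 <= j < L.+1) nth 0 a (L - j).
  rewrite sumnE (big_nth 0) [RHS]big_nat_rev /=.
  rewrite [RHS](@big_cat_nat _ _ _ (size a)) //=; last by lia.
  rewrite [X in _ = _ + X]big_nat [X in _ = _ + X]big1 ?addn0.
    by apply: eq_big_nat => i hi; congr nth; lia.
  by move=> i hi; rewrite nth_default //; lia.
rewrite sumnE [\sum_(i <- h) i](big_nth 0) sh -big_split /=.
by apply: eq_big_nat => j hj; rewrite addnC E.
Qed.

(** * The correspondence between partitions and area sequences *)

Definition gaps_of_part (L : nat) (a : seq nat) : seq nat :=
  mkseq (fun j => j - nth 0 a (L - j)) L.+1.

Definition part_of_gaps (L : nat) (h : seq nat) : seq nat :=
  filter (fun x => 0 < x) (mkseq (fun i => L - i - nth 0 h (L - i)) L).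

(** A zero entry on diagonal [L.+1] says [a_i + i <= L] for [i <= L]: the diagram fits in the
    staircase and the subtractions are exact. *)
Lemma gaps_of_partP L a : part_seq a -> diag_entry a L.+1 = 0 ->
  stair_gaps L a (gaps_of_part L a).
Proof.
move=> /andP[_ /allP pa] /eqP; rewrite /diag_entry -leqn0 leqNgt -has_count => /hasPn E.
have {}E i : i <= L -> nth 0 a i + i <= L.
  by move=> iL; have := E i.+1; rewrite mem_iota /part_at /=; lia.
split; first by rewrite size_mkseq.
  rewrite leqNgt; apply/negP => /(mem_nth 0)/pa.
  by have := E L (leqnn L) => /=; lia.
by move=> j jL; rewrite nth_mkseq //; have := E (L - j); lia.
Qed.

(** [h_{j+1} - h_j] is 1 minus a difference of consecutive parts, which is nonnegative. *)
Lemma stair_gaps_area L a h : sorted geq a -> stair_gaps L a h -> area_seq h.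
Proof.
move=> sa [sh _ E]; apply/andP; split.
  by rewrite -nth0; have := E 0; lia.
apply/(sortedP 0) => i; rewrite sh ltnS => iL; rewrite /climb.
have := E i; have := E i.+1; have := @part_seq_nthS a (L - i.+1) sa.
have -> : (L - i.+1).+1 = L - i by lia.
by lia.
Qed.

Lemma stair_gaps_inj L a a' h : part_seq a -> part_seq a' ->
  stair_gaps L a h -> stair_gaps L a' h -> a = a'.
Proof.
move=> pa pa' [_ sa E] [_ sa' E'].
apply: eq_from_nth_last; try exact: last_part_seq.
move=> i; case: (leqP i L) => iL; last by rewrite !nth_default //; lia.
have := E (L - i) (leq_subr _ _); have := E' (L - i) (leq_subr _ _).
by rewrite subKn //; lia.
Qed.

Lemma stair_gaps_fun L a h h' :
  stair_gaps L a h -> stair_gaps L a h' -> h = h'.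
Proof.
move=> [sh _ E] [sh' _ E']; apply: (@eq_from_nth _ 0); rewrite sh ?sh' //.
by move=> j jL; have := E j; have := E' j; lia.
Qed.

(** The zeros form a suffix, and the default 0 of [nth] replaces them. *)
Lemma nth_filter_pos (s : seq nat) i : sorted geq s ->
  nth 0 (filter (fun x => 0 < x) s) i = nth 0 s i.
Proof.
elim: s i => [|x s IH] i // ps; have ss := path_sorted ps.
rewrite /=; case: ltnP => hx; first by case: i => //= i; rewrite IH.
rewrite IH //.
have all0 : all (pred1 0) (x :: s).
  have /allP H := order_path_min (rev_trans leq_trans) ps.
  by apply/allP => y; rewrite inE => /orP[/eqP->|/H] /=; lia.
have N j : nth 0 (x :: s) j = 0.
  case: (ltnP j (size (x :: s))) => hj; last by rewrite nth_default.
  by have /eqP := allP all0 _ (mem_nth 0 hj).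
by rewrite N; have := N i.+1.
Qed.

Lemma part_of_gapsP L h : area_seq h -> size h = L.+1 ->
  part_seq (part_of_gaps L h) /\ stair_gaps L (part_of_gaps L h) h.
Proof.
move=> /andP[h0 /(sortedP 0) sh] zh.
(* This makes the truncated subtraction in [part_of_gaps] exact. *)
have le_id j : j <= L -> nth 0 h j <= j.
  elim: j => [|j IH] hj; first by rewrite nth0 (eqP h0).
  by have := sh j; rewrite zh /climb; have := IH (ltnW hj); lia.
have srt : sorted geq (mkseq (fun i => L - i - nth 0 h (L - i)) L).
  apply/(sortedP 0) => i; rewrite size_mkseq => hi; rewrite !nth_mkseq; try lia.
  have := sh (L - i.+1); rewrite zh /climb /=.
  have -> : (L - i.+1).+1 = L - i by lia.
  by lia.
split.
  rewrite /part_seq filter_all andbT sorted_filter //; exact: rev_trans leq_trans.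
split=> //; first by rewrite size_filter (leq_trans (count_size _ _)) ?size_mkseq.
move=> j jL; rewrite nth_filter_pos //.
case: (posnP j) => [->|j0].
  by rewrite subn0 nth0 (eqP h0) nth_default ?size_mkseq.
by rewrite nth_mkseq ?subKn //; [have := le_id j; lia | lia].
Qed.

Theorem theorem4p6 (n : nat) (d : seq nat) :
  0 < n -> in_Delta n d ->
  let L := size d in
  let q := \max_(x <- d) x in
  exists s : seq (seq nat),
    [/\ uniq s,
        (forall a : seq nat, (a \in s) = is_partition n a && (delta a == d)) &
        size s = \prod_(q <= i < L) 'C(bcoef d i + bcoef d i.+1 + 1, bcoef d i + 1)].
Proof.
move=> n0 [a0 [/and3P[sa0 pa0 /eqP na0] da0]] L q.
have P0 : part_seq a0 by apply/andP.
have diagE a k : delta a = d -> 0 < k -> diag_entry a k = dseq d k.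
  by move=> <-; case: k => // k _; rewrite /dseq nth_delta.
have diagL a : delta a = d -> diag_entry a L.+1 = 0.
  by move=> da; rewrite (diagE a) // /dseq nth_default.
have G0 := gaps_of_partP P0 (diagL _ da0).
set h0 := gaps_of_part L a0 in G0.
have ah0 := stair_gaps_area sa0 G0.
have zh0 : size h0 = L.+1 by case: G0.
(* The fibre of [d] corresponds to the area sequences that rearrange [h0]. *)
have [s [us ms ss]] := area_seq_perm_enum ah0.
have sP h : h \in s -> [/\ perm_eq h h0, part_seq (part_of_gaps L h) &
    stair_gaps L (part_of_gaps L h) h].
  rewrite ms => /andP[ah ph]; have [] // := @part_of_gapsP L h ah.
  by rewrite (perm_size ph).
exists (map (part_of_gaps L) s); split.
- rewrite map_inj_in_uniq // => h h' /sP[_ _ G] /sP[_ _ G'] E.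
  by rewrite E in G; apply: stair_gaps_fun G G'.
- move=> a; apply/mapP/andP => [[h /sP[ph pa G] ->]|[/and3P[sa pa /eqP na] /eqP da]].
    move: (part_of_gaps L h) pa G => b pb G; split.
      case/andP: (pb) => sb ppb; rewrite /is_partition sb ppb /=.
      have := sumn_stair_gaps G; have := sumn_stair_gaps G0.
      by rewrite (perm_sumn ph) na0; lia.
    rewrite -da0; apply/eqP/delta_eqP => k k0.
    case: (leqP k L) => kL; last by rewrite (diag_entry_stair0 G) ?(diag_entry_stair0 G0).
    have := @count_stair_gaps _ _ _ k G; have := @count_stair_gaps _ _ _ k G0.
    by rewrite k0 kL (permP ph) => -> // /(_ isT) /addIn.
  have P : part_seq a by apply/andP.
  have G := gaps_of_partP P (diagL _ da); have ah := stair_gaps_area sa G.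
  exists (gaps_of_part L a).
    rewrite ms ah; apply: perm_eq_count_leq => v.
    case: (ltnP v L) => vL.
      have -> : v = L - (L - v) by lia.
      have hv : 0 < L - v <= L by lia.
      rewrite (count_stair_gaps G hv) (count_stair_gaps G0 hv) !diagE //; lia.
    (* For [v >= L] no diagonal is involved: all [L.+1] gaps are counted. *)
    have big a' h' : stair_gaps L a' h' -> count (fun x => x <= v) h' = L.+1.
      move=> G'; have [<- _ _] := G'; apply/eqP; rewrite -all_count.
      by apply/allP => x /(stair_gaps_leq G') /leq_trans; apply.
    by rewrite (big _ _ G) (big _ _ G0).
  have [P' G'] := part_of_gapsP ah (size_mkseq _ _).
  exact: stair_gaps_inj P P' G G'.
- rewrite size_map ss; set M := \max_(x <- h0) x.
  have countE k : 0 < k <= L ->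
      count (fun x => x <= L - k) h0 = dseq d k + (L.+1 - k).
    by move=> hk; rewrite (count_stair_gaps G0 hk) diagE //; lia.
  have count_le v : count (fun x => x <= v) h0 <= L.+1 by rewrite -zh0 count_size.
  have count_M v : M <= v -> count (fun x => x <= v) h0 = L.+1.
    move=> Mv; apply/eqP; rewrite -zh0 -all_count.
    by apply/allP => x /leq_bigmax_mem /leq_trans; apply.
  have h0n : h0 != [::] by rewrite -size_eq0 zh0.
  have d1 : dseq d 1 = 1.
    rewrite -(diagE a0) // /diag_entry /part_at /=.
    by case: (a0) pa0 na0 => [|x l] /=; lia.
  have L0 : 0 < L by rewrite lt0n size_eq0; apply: contra_eq_neq d1 => ->.
  (* Since [d_1 = 1], all [L.+1] gaps are at most [L - 1]. *)
  have ML : M < L.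
    have /eqP : count (fun x => x <= L - 1) h0 = size h0 by rewrite countE // d1 zh0; lia.
    by rewrite -all_count => /allP/(_ _ (bigmax_mem h0n)); rewrite -/M; lia.
  (* At [k = L - M] every gap is counted, so [d_k = k]. Smaller [k] give [d_k <= k]; for larger [k],
     each level from [L - k + 1] to [M] holds a gap not counted in [d_k]. *)
  have qE : q = L - M.
    have hd : dseq d (L - M) = L - M.
      by have := countE (L - M); rewrite count_M; lia.
    apply/eqP; rewrite eqn_leq; apply/andP; split; last first.
      by rewrite -{1}hd; apply/leq_bigmax_mem/mem_nth; rewrite -/L; lia.
    apply/bigmax_leqP_seq => x /(nthP 0)[k kL <-] _; rewrite -/L in kL.
    suff: dseq d k.+1 <= L - M by [].
    have := countE k.+1.
    case: (leqP M (L - k.+1)) => hk; first by have := count_le (L - k.+1); lia.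
    have := @area_seq_count_leq h0 (L - k.+1) (M - (L - k.+1)) ah0.
    by rewrite -/M; have := count_le (L - k.+1 + (M - (L - k.+1))); lia.
  (* The extra 1 is the change of [L.+1 - k] between consecutive [k]. *)
  have cE k : L - M <= k <= L -> bcoef d k + 1 = count_mem (L - k) h0.
    move=> hk; have := countE k; rewrite /bcoef.
    case: (ltnP k L) => kL; last first.
      have -> : L - k = 0 by lia.
      by rewrite count_leq0 [dseq d k.+1]nth_default //=; lia.
    have -> : L - k = (L - k.+1).+1 by lia.
    rewrite count_leqS => C1; have := countE k.+1.
    (* An occupied level keeps the subtraction in [bcoef] from truncating. *)
    have : 0 < count_mem (L - k.+1).+1 h0.
      rewrite -has_count has_pred1; apply: mem_area_seq (bigmax_mem h0n) _ => //.
      by rewrite -/M; lia.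
    by move: C1; lia.
  rewrite qE -[L - M in RHS]add0n big_addn subKn; last by lia.
  (* The factor for level [v] matches [i = L - v.+1], so levels [v] and [v.+1] have multiplicities
     [b_{i+1} + 1] and [b_i + 1]. *)
  rewrite [RHS]big_nat_rev; apply: eq_big_nat => v /andP[_ vM].
  have -> : 0 + M - v.+1 + (L - M) = L - v.+1 by lia.
  have -> : (L - v.+1).+1 = L - v by lia.
  have := cE (L - v.+1); have := cE (L - v).
  rewrite !subKn; try lia.
  move=> E1 E2; rewrite -E1 -?E2; try lia.
  by congr 'C(_, _); lia.
Qed.
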